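(* Let $m\geqslant 4$ and $k\geqslant 3$ be integers, and for each $i\in\{0,1,\dots,m-1\}$ let $G_i$ be a $k$-regular $k$-edge-connected graph of order $n$ without triangles. If $n>\left\lceil\frac{3k+2}{2}\right\rceil$, then $G=G(G_0,G_1,\dots,G_{m-1};\mathscr{M})$ is super-$\lambda''$ and $\rho'(G)=k+1$, where $\mathscr{M}$ is any union of perfect matchings as described in the context.
   Context: All graphs are finite and simple. Let $G_0,\dots,G_{m-1}$ be $m\geqslant 3$ graphs with the same number of vertices (on pairwise disjoint vertex-sets). For each $i$, let $M_{i,i+1 (\mathrm{mod}\ m)}$ be an arbitrary perfect matching between $V(G_i)$ and $V(G_{i+1 (\mathrm{mod}\ m)})$ (its edges realize a bijection between the two vertex-sets), and let $\mathscr{M}=\bigcup_{i=0}^{m-1}M_{i,i+1 (\mathrm{mod}\ m)}$. Then $G(G_0,G_1,\dots,G_{m-1};\mathscr{M})$ is the graph with vertex-set $V(G_0)\cup\cdots\cup V(G_{m-1})$ and edge-set $E(G_0)\cup\cdots\cup E(G_{m-1})\cup\mathscr{M}$. For a connected graph $G=(V,E)$ and an integer $h\geqslant 0$, a set $F\subseteq E(G)$ is an $h$-extra edge-cut if $G-F$ is disconnected and every component of $G-F$ has more than $h$ vertices. If such a set exists, $\lambda^{(h)}(G)$ is the minimum cardinality of an $h$-extra edge-cut, and $G$ is called $\lambda^{(h)}$-connected. A $\lambda^{(h)}$-cut is an $h$-extra edge-cut of cardinality $\lambda^{(h)}(G)$. Write $\lambda'=\lambda^{(1)}$ and $\lambda''=\lambda^{(2)}$.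 For $X\subset V(G)$, $d_G(X)$ is the number of edges between $X$ and $V(G)\setminus X$, and $\xi_h(G)=\min\{d_G(X): X\subset V(G),\ |X|=h+1,\ G[X]\text{ connected}\}$. A $\lambda^{(h)}$-connected graph $G$ is $\lambda^{(h)}$-optimal if $\lambda^{(h)}(G)=\xi_h(G)$, and it is super-$\lambda^{(h)}$ if it is $\lambda^{(h)}$-optimal and, for every $\lambda^{(h)}$-cut $F$ of $G$, some component of $G-F$ has exactly $h+1$ vertices. Super-$\lambda'$ and super-$\lambda''$ are the cases $h=1,2$. A disconnected graph is not super-$\lambda^{(h)}$. For a super-$\lambda'$ graph $G$, the persistence $\rho'(G)$ is the maximum integer $r$ such that $G-F$ is still super-$\lambda'$ for every $F\subseteq E(G)$ with $|F|\leqslant r$. Any assertion about $\rho'(G)$ includes the assertion that $G$ is super-$\lambda'$. *)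

(* Defs.v *)
From mathcomp Require Import all_boot.

Set Implicit Arguments.
Unset Strict Implicit.
Unset Printing Implicit Defensive.

Record sgraph := SGraph {
  vertex :> finType;
  adj : rel vertex;
  adj_sym : symmetric adj;
  adj_irr : irreflexive adj
}.
Arguments adj {s}.

Definition edges (G : sgraph) : {set {set G}} :=
  [set [set x; y] | x in [set: G], y in [set y | adj x y]].

Definition regular (k : nat) (G : sgraph) : bool :=
  [forall x : G, #|[set y : G | adj x y]| == k].

Definition triangle_free (G : sgraph) : bool :=
  [forall x : G, forall y : G, forall z : G,
     ~~ [&& adj x y, adj y z & adj z x]].

Definition connected (G : sgraph) : bool :=
  [forall x : G, forall y : G, connect adj x y].

Definition components (G : sgraph) : {set {set G}} :=
  equivalence_partition (connect adj) [set: G].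

Section Subgraphs.
Variable G : sgraph.

Definition del_adj (F : {set {set G}}) : rel G :=
  [rel x y | adj x y && ([set x; y] \notin F)].

Lemma del_adj_sym F : symmetric (del_adj F).
Proof. by move=> x y; rewrite /del_adj /= adj_sym setUC. Qed.

Lemma del_adj_irr F : irreflexive (del_adj F).
Proof. by move=> x; rewrite /del_adj /= adj_irr. Qed.

Definition del_edges (F : {set {set G}}) : sgraph :=
  SGraph (del_adj_sym F) (del_adj_irr F).

Definition ind_adj (X : {set G}) : rel {x : G | x \in X} :=
  [rel x y | adj (val x) (val y)].

Lemma ind_adj_sym X : symmetric (ind_adj (X := X)).
Proof. by move=> x y; exact: adj_sym. Qed.

Lemma ind_adj_irr X : irreflexive (ind_adj (X := X)).
Proof. by move=> x; exact: adj_irr. Qed.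

Definition induced (X : {set G}) : sgraph :=
  SGraph (@ind_adj_sym X) (@ind_adj_irr X).

End Subgraphs.

(* The one-vertex graph satisfies this for every k. *)
Definition edge_connected (k : nat) (G : sgraph) : bool :=
  [forall (F : {set {set G}} | (F \subset edges G) && (#|F| < k)),
     connected (del_edges F)].

Definition extra_edge_cut (h : nat) (G : sgraph) (F : {set {set G}}) : bool :=
  [&& F \subset edges G,
      ~~ connected (del_edges F) &
      [forall C in components (del_edges F), h < #|C|]].

Definition lambda_connected (h : nat) (G : sgraph) : bool :=
  connected G && [exists F : {set {set G}}, extra_edge_cut h F].

(* Meaningful only when G is lambda_connected h; otherwise [edges G] is an
   arbitrary default. *)
Definition lambda (h : nat) (G : sgraph) : nat :=
  #|[arg min_(F < edges G | extra_edge_cut h F) #|F|]|.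

Definition lambda_cut (h : nat) (G : sgraph) (F : {set {set G}}) : bool :=
  extra_edge_cut h F && (#|F| == lambda h G).

Definition degree_set (G : sgraph) (X : {set G}) : nat :=
  #|[set [set x; y] | x in X, y in ~: X & adj x y]|.

(* [set0] is an arbitrary default; when G is lambda_connected h, any h + 1
   vertices spanning a connected subgraph of a component of G - F witness that
   the minimum is over a nonempty family. *)
Definition xi (h : nat) (G : sgraph) : nat :=
  degree_set [arg min_(X < (set0 : {set G}) |
    [&& X \proper [set: G], #|X| == h.+1 & connected (induced X)])
    degree_set X].

Definition lambda_optimal (h : nat) (G : sgraph) : bool :=
  lambda_connected h G && (lambda h G == xi h G).

Definition super_lambda (h : nat) (G : sgraph) : bool :=
  lambda_optimal h G &&
  [forall (F : {set {set G}} | lambda_cut h F),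
     [exists C in components (del_edges F), #|C| == h.+1]].

Definition persists (G : sgraph) (r : nat) : Prop :=
  forall F : {set {set G}},
    F \subset edges G -> #|F| <= r -> super_lambda 1 (del_edges F).

(* rho'(G) = r, including the assertion that rho'(G) is defined. *)
Definition persistence_is (G : sgraph) (r : nat) : Prop :=
  [/\ super_lambda 1 G, persists G r & forall s, persists G s -> s <= r].

Section Cyclic.
Variables (m : nat) (G : 'I_m -> sgraph).

(* M i is the matching between G_i and G_(i + 1 mod m), as a function; it is a
   perfect matching when M i is bijective. The tagged sum makes the vertex sets
   disjoint. *)
Variable M : forall i : 'I_m, G i -> G (ordS i).

Let V : finType := {i : 'I_m & G i}.

Definition layer_adj : rel V :=
  [rel u v | (tag u == tag v) && adj (tagged u) (tagged_as u v)].

Definition match_adj : rel V :=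
  [rel u v | Tagged (fun i => G i : Type) (M (tagged u)) == v].

(* The conjunct u != v matters only for m = 1, where ordS i = i. *)
Definition cyclic_adj : rel V :=
  [rel u v | (u != v) && [|| layer_adj u v, match_adj u v | match_adj v u]].

Lemma layer_adj_sym : symmetric layer_adj.
Proof.
move=> [i x] [j y]; rewrite /layer_adj /=.
case: (eqVneq i j) => [eij|//].
by case: j / eij y => y; rewrite /= !tagged_asE adj_sym.
Qed.

Lemma cyclic_adj_sym : symmetric cyclic_adj.
Proof.
by move=> u v; rewrite /cyclic_adj /= eq_sym layer_adj_sym (orbC (match_adj u v)).
Qed.

Lemma cyclic_adj_irr : irreflexive cyclic_adj.
Proof. by move=> u; rewrite /cyclic_adj /= eqxx. Qed.

Definition cyclic_graph : sgraph := SGraph cyclic_adj_sym cyclic_adj_irr.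

End Cyclic.

(* Main.v *)
(* The graph is triangle-free and (k+2)-regular, so by Mantel's theorem a set of
   s vertices has a cut of at least s (k+2) - s^2 / 2 edges, which is at least
   3k+3 for 4 <= s <= 2k and at least 3k+2 for s = 3.  A set X that is large
   together with its complement also has at least 3k+3 cut edges.  A layer met
   by X properly contributes k of them, and going around the cycle the sizes of
   the layers of X vary, so the matchings contribute twice the difference
   between any two layer sizes.  Hence one concludes if four layers are met
   properly or if one is full and another is empty; otherwise, up to
   complement, X lies in at most three layers and some layer is empty, so that
   |X| > 2k forces a large layer size.

   Any extra cut contains the cut of a component, so a graph is super-lambda^(h)
   as soon as every set X larger than h+1 with complement larger than h+1 has a
   larger cut than some connected set of h+1 vertices.  For h = 2 a path with
   three vertices, of cut 3k+2, does.  For h = 1 and G - F with |F| <= k+1, an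
   edge at a vertex incident with the most edges of F does.  Deleting the k+2
   edges at a vertex shows that k+1 is optimal. *)

Require Import Defs.
From mathcomp Require Import all_boot.
From mathcomp Require Import zify.

Set Implicit Arguments.
Unset Strict Implicit.
Unset Printing Implicit Defensive.

(* The defaults in [xi] and [lambda] do not satisfy the minimised predicate, so
   [arg_minnP] does not apply to them. *)
Lemma arg_min_defaultP (I : finType) (i0 i1 : I) (P : pred I) (F : I -> nat) :
  P i1 -> extremum_spec leq P F [arg min_(i < i0 | P i) F i].
Proof.
move=> Pi1; suff -> : [arg min_(i < i0 | P i) F i] = arg_min i1 P F.
  exact: arg_minnP.
rewrite /arg_min /extremum; have [i _ //|no] := pickP _.
case: (arg_minnP F Pi1) => i Pi min; move: (no i) => /=.
rewrite Pi /= => /negP[]; apply/forallP => j; apply/implyP; exact: min.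
Qed.

(** * Cuts, degree sums and Mantel's bound *)

Section Graph.
Variable H : sgraph.
Implicit Types (X Y : {set H}) (F : {set {set H}}).

Definition cut X : {set {set H}} :=
  [set [set x; y] | x in X, y in ~: X & adj x y].

Lemma cutP X e :
  reflect (exists x y, [/\ x \in X, y \notin X, adj x y & e = [set x; y]])
          (e \in cut X).
Proof.
apply: (iffP imset2P) => [[x y xX]|[x [y [xX yX xy ->]]]].
  by rewrite !inE => /andP[yX xy] ->; exists x, y.
by exists x y; rewrite ?inE ?yX.
Qed.

Lemma mem_cut X x y :
  adj x y -> ([set x; y] \in cut X) = ((x \in X) != (y \in X)).
Proof.
move=> xy; apply/cutP/idP => [[u [v [uX vX _ e]]]|].
  have := set21 x y; have := set22 x y; rewrite e !inE.
  have := set21 u v; have := set22 u v; rewrite -e !inE.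
  by move=> /orP[]/eqP ? /orP[]/eqP ?; subst; rewrite ?eqxx ?uX ?(negPf vX) ?orbT //;
    move: uX; rewrite (negPf vX).
have [xX|xX] := boolP (x \in X); have [yX|yX] := boolP (y \in X) => // _.
  by exists x, y.
by exists y, x; rewrite adj_sym setUC.
Qed.

Lemma cut_sub_edges X : cut X \subset edges H.
Proof.
apply/subsetP => e /cutP[x [y [_ _ xy ->]]].
by apply/imset2P; exists x y; rewrite ?inE.
Qed.

Lemma cutC X : cut (~: X) = cut X.
Proof.
apply/setP => e; apply/cutP/cutP => -[x [y [xX yX xy ->]]];
  exists y, x; rewrite !inE ?negbK in xX yX *;
  by rewrite adj_sym setUC.
Qed.

Lemma degree_setC X : degree_set (~: X) = degree_set X.
Proof. by rewrite /degree_set -!/(cut _) cutC. Qed.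

Lemma degree_setE X :
  degree_set X = \sum_(x in X) \sum_(y in ~: X) adj x y.
Proof.
pose A := [set p : H * H | [&& p.1 \in X, p.2 \notin X & adj p.1 p.2]].
have -> : degree_set X = #|[set [set p.1; p.2] | p in A]|.
  congr #|pred_of_set _|; apply/setP => e; apply/cutP/imsetP.
    by move=> [x [y [xX yX xy ->]]]; exists (x, y); rewrite ?inE /= ?xX ?yX.
  by move=> [[x y]]; rewrite inE => /and3P[? ? ?] ->; exists x, y.
(* Membership in [X] orients each cut edge, so no unordered pair comes from two ordered ones. *)
rewrite card_in_imset; last first.
  move=> [x y] [u v]; rewrite !inE /= => /and3P[xX yX _] /and3P[uX vX _] e.
  have := set21 x y; have := set22 x y; rewrite e !inE.
  move=> /orP[]/eqP ? /orP[]/eqP ?; subst => //; by rewrite ?uX ?xX in yX vX.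
rewrite pair_big_dep /= -sum1_card big_mkcond [RHS]big_mkcond /=.
apply: eq_bigr => -[x y] _; rewrite !inE /=.
by case: (x \in X); case: (y \in X); case: adj.
Qed.

Definition deg (x : H) := \sum_y adj x y.

Lemma degE x : deg x = #|[set y | adj x y]|.
Proof.
rewrite /deg -sum1_card [RHS]big_mkcond; apply: eq_bigr => y _.
by rewrite inE; case: adj.
Qed.

(** Twice the number of edges inside [X], as each is counted in both directions. *)
Definition arcs_in X := \sum_(x in X) \sum_(y in X) adj x y.

Lemma sum_deg X : \sum_(x in X) deg x = degree_set X + arcs_in X.
Proof.
rewrite degree_setE -big_split /=; apply: eq_bigr => x _.
rewrite /deg (bigID (mem X)) /= addnC; congr (_ + _).
by apply: eq_bigl => y; rewrite inE.
Qed.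

(** The neighbours [N] in [X] of a vertex of maximum degree inside [X] are independent, so the arcs
    from [N] end in [R] and are no more than those from [R], hence at most [|R| |N|]. Thus
    [arcs_in X <= 2 |R| |N|], and AM-GM concludes. *)
Lemma mantel X : triangle_free H -> 2 * arcs_in X <= #|X| ^ 2.
Proof.
move=> tf; have [->|/set0Pn[x0 x0X]] := eqVneq X set0.
  by rewrite /arcs_in big_set0.
pose dX x := \sum_(y in X) adj x y.
have [v vX vmax] := @arg_maxnP _ x0 (mem X) dX x0X.
(* N is independent, so every edge of X meets R. *)
pose N := [set y in X | adj v y]; pose R := X :\: N.
have cN : #|N| = dX v.
  rewrite /dX -sum1_card big_mkcond [RHS]big_mkcond /=; apply: eq_bigr => y _.
  by rewrite inE; case: (y \in X); case: adj.
have NX : N \subset X by apply/subsetP => y; rewrite inE => /andP[].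
have splitX (f : H -> nat) :
    \sum_(x in X) f x = \sum_(x in N) f x + \sum_(x in R) f x.
  rewrite (big_setID N) /=; congr (_ + _).
  by rewrite (setIidPr NX).
have le1 : \sum_(x in R) dX x <= #|R| * dX v.
  rewrite -sum_nat_const; apply: leq_sum => x; rewrite inE => /andP[_ xX].
  exact: vmax.
have le2 : \sum_(x in N) dX x <= \sum_(x in R) dX x.
  rewrite /dX [leqRHS]exchange_big /= splitX.
  rewrite (leq_trans _ (leq_addr _ _)) //; apply: leq_sum => x xN.
  rewrite splitX [X in X + _]big1 ?add0n; last first.
    move=> y yN; apply/eqP; rewrite eqb0; apply/negP => xy.
    move: xN yN; rewrite !inE => /andP[_ vx] /andP[_ vy].
    move: tf => /forallP/(_ v)/forallP/(_ x)/forallP/(_ y).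
    by rewrite vx xy adj_sym vy.
  by apply: leq_sum => y _; rewrite adj_sym.
have cR : #|R| + #|N| = #|X|.
  by rewrite cardsD (setIidPr NX) subnK // subset_leq_card.
have -> : arcs_in X = \sum_(x in N) dX x + \sum_(x in R) dX x by rewrite -splitX.
have [+ _] := nat_AGM2 #|R| #|N|; rewrite cR cN; lia.
Qed.

Lemma sconnect_sym : connect_sym (@adj H).
Proof. exact/sym_connect_sym/adj_sym. Qed.

Lemma connected_cut X :
  connected H -> 0 < #|X| -> 0 < #|~: X| -> 0 < degree_set X.
Proof.
move=> cH /card_gt0P[x xX] /card_gt0P[y]; rewrite inE => yX.
rewrite lt0n; apply/negP => /eqP/cards0_eq; rewrite -/(cut X) => cut0.
move: cH => /forallP/(_ x)/forallP/(_ y) xy.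
have cl : closed adj X.
  move=> u v uv; have := in_set0 [set u; v].
  by rewrite -cut0 mem_cut //; case: (u \in X); case: (v \in X).
by move: yX; rewrite -(closed_connect cl xy) xX.
Qed.

Lemma cut_connected :
  (forall X, 0 < #|X| -> 0 < #|~: X| -> 0 < degree_set X) -> connected H.
Proof.
move=> dpos; apply/forallP => x; apply/forallP => y.
pose X := [set z | connect adj x z].
have [//|nxy] := boolP (connect adj x y).
have xX : x \in X by rewrite inE connect0.
have yX : y \in ~: X by rewrite !inE.
have /dpos : 0 < #|X| by apply/card_gt0P; exists x.
have -> : 0 < #|~: X| by apply/card_gt0P; exists y.
case/(_ isT)/card_gt0P => e /cutP[u [v []]]; rewrite !inE => xu /negP nxv uv _.
by case: nxv; exact: connect_trans xu (connect1 uv).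
Qed.

Lemma componentsP C :
  reflect (exists x, C = [set y | connect adj x y]) (C \in components H).
Proof.
apply: (iffP imsetP) => [[x _ ->]|[x ->]]; exists x => //;
  by apply/setP => y; rewrite !inE.
Qed.

Lemma edge_connected_cut k X :
  edge_connected k H -> 0 < #|X| -> 0 < #|~: X| -> k <= degree_set X.
Proof.
move=> /forall_inP/(_ (cut X)) ec X0 X1; rewrite leqNgt; apply/negP => lt.
move: ec; rewrite cut_sub_edges => /(_ lt) cH.
move: (X0) => /card_gt0P[x xX]; move: (X1) => /card_gt0P[y]; rewrite inE => yX.
move: cH => /forallP/(_ x)/forallP/(_ y) xy.
have cl : closed (@adj (del_edges (cut X))) X.
  move=> u v /andP[uv]; rewrite mem_cut //.
  by case: (u \in X); case: (v \in X).
by move: yX; rewrite -(closed_connect cl xy) xX.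
Qed.

End Graph.

(** * Components after edge deletion *)

Section Delete.
Variables (H : sgraph) (F : {set {set H}}).
Implicit Types X Y : {set H}.
Local Notation HF := (del_edges F).

Definition comp (x : H) : {set H} := [set y | connect (@adj HF) x y].

Lemma cut_del X : cut (X : {set HF}) = cut X :\: F.
Proof.
apply/setP => e; rewrite inE; apply/cutP/andP.
  by move=> [x [y [xX yX /andP[xy nF] ->]]]; split=> //; apply/cutP; exists x, y.
move=> [nF /cutP[x [y [xX yX xy ee]]]]; exists x, y; split=> //.
by apply/andP; rewrite -ee.
Qed.

Lemma degree_set_del X :
  degree_set X <= degree_set (X : {set HF}) + #|F|.
Proof.
rewrite /degree_set -/(cut X) -/(cut (X : {set HF})) cut_del.
rewrite -(cardsID F (cut X)) addnC leq_add2l.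
by rewrite subset_leq_card // subsetIr.
Qed.

Lemma cut_comp x : cut (comp x) \subset F.
Proof.
apply/subsetP => e /cutP[u [v []]]; rewrite !inE => xu nxv uv ->.
apply: contraNT nxv => nF; apply: connect_trans xu _.
by apply: connect1; apply/andP.
Qed.

Lemma comp_induced x : connected (induced (comp x)).
Proof.
set X := comp x.
have xX : x \in X by rewrite inE connect0.
have to (y : induced X) : connect adj (Sub x xX : induced X) y.
  have := valP y; rewrite [val y \in X]inE => /connectP[p].
  (* Induction at the far end keeps every prefix starting at [x], so its last vertex lies in the
     component. *)
  elim/last_ind: p y => [|p z IH] y /=.
    by move=> _ e; rewrite (_ : Sub x xX = y) ?connect0 //; apply: val_inj.
  rewrite rcons_path last_rcons => /andP[pp /andP[az _]] ez.
  have lX : last x p \in X by rewrite inE; apply/connectP; exists p.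
  apply: connect_trans (IH (Sub (last x p) lX) pp erefl) _.
  by apply: connect1; rewrite /= /ind_adj /= ez.
apply/forallP => y; apply/forallP => z.
by apply: connect_trans (to z); rewrite sconnect_sym.
Qed.

End Delete.

(** * A criterion for super-lambda^(h) *)

Lemma induced_connect (H : sgraph) (X : {set H}) (r : rel H) x y :
  {in X &, forall u v, adj u v -> r u v} -> connected (induced X) ->
  x \in X -> y \in X -> connect r x y.
Proof.
move=> sub cX xX yX.
move: cX => /forallP/(_ (Sub x xX))/forallP/(_ (Sub y yX))/connectP[p pp e].
have -> : y = last x (map val p) by rewrite -[x]/(val (Sub x xX : induced X)) last_map -e.
apply/connectP; exists (map val p) => //.
elim: p x xX pp {e} => //= z p IH x xX /andP[xz pp].
rewrite (sub x (val z)) ?(valP z) //=; apply: IH (valP z) _.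
by congr (path _ _ _): pp; apply: val_inj.
Qed.

(* The hypothesis also yields that the cut of an optimal X0 isolates no small
   component: such a component could be added to X0 without increasing the
   cut. *)
Lemma super_lambdaI (H : sgraph) (h : nat) :
  connected H -> 2 * h + 4 <= #|H| -> 3 * h + 3 <= #|H| ->
  (forall X : {set H}, h.+1 < #|X| -> h.+1 < #|~: X| ->
    exists Y : {set H}, [/\ #|Y| = h.+1, connected (induced Y) &
      degree_set Y < degree_set X]) ->
  super_lambda h H.
Proof.
move=> cH N1 N2 small.
(* Applying [small] to any [h + 2] vertices shows that [xi] minimises over a nonempty family;
   [2 * h + 4 <= #|H|] makes the complement large enough. *)
have [Y0 cY0 conY0] : exists2 Y : {set H}, #|Y| = h.+1 & connected (induced Y).
  have /card_geqP[s [us ss _]] : h.+2 <= #|H| by lia.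
  have cs : #|[set:: s]| = h.+2 by rewrite cardsE (card_uniqP us).
  have := cardsC [set:: s]; rewrite cs => cC.
  by have [||Y [cY conY _]] := small [set:: s]; rewrite ?cs; try lia; exists Y.
pose P := [pred X : {set H} |
  [&& X \proper [set: H], #|X| == h.+1 & connected (induced X)]].
have PI (X : {set H}) : #|X| = h.+1 -> connected (induced X) -> P X.
  move=> cX conX; apply/and3P; split=> //; last by rewrite cX.
  rewrite properE subsetT /=; apply/negP => /subset_leq_card.
  rewrite cardsT; lia.
have [X0 PX0 xiE] : exists2 X0, P X0 &
    xi h H = degree_set X0 /\ forall Y, P Y -> xi h H <= degree_set Y.
  rewrite /xi.
  by have [X0] := arg_min_defaultP set0 (@degree_set H) (PI _ cY0 conY0); exists X0.
case: xiE => xiE minP.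
have xi_min (X : {set H}) : #|X| = h.+1 -> connected (induced X) ->
    xi h H <= degree_set X by move=> cX conX; exact/minP/PI.
(* If neither of two distinct components has [h + 1] vertices, both are larger, and [small] makes
   the cut of one of them, hence [F], exceed [xi h H]. *)
have low (F : {set {set H}}) : extra_edge_cut h F -> xi h H <= #|F| /\
    (#|F| <= xi h H -> exists2 C, C \in components (del_edges F) & #|C| == h.+1).
  move=> /and3P[_ ncon /forall_inP big].
  move: ncon => /forallPn[x] /forallPn[y] nxy.
  have compc z : comp F z \in components (del_edges F).
    by apply/componentsP; exists z.
  have cut_le z : degree_set (comp F z) <= #|F|.
    exact/subset_leq_card/cut_comp.
  have sub : comp F y \subset ~: comp F x.
    apply/subsetP => z; rewrite !inE => yz; apply: contra nxy => xz.
    by apply: connect_trans xz _; rewrite sconnect_sym.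
  have bx := big _ (compc x); have by_ := big _ (compc y).
  have le := subset_leq_card sub.
  have [ex|nx] := eqVneq #|comp F x| h.+1.
    split; last by move=> _; exists (comp F x); rewrite ?ex.
    exact: leq_trans (xi_min _ ex (comp_induced F x)) (cut_le x).
  have [ey|ny] := eqVneq #|comp F y| h.+1.
    split; last by move=> _; exists (comp F y); rewrite ?ey.
    exact: leq_trans (xi_min _ ey (comp_induced F y)) (cut_le y).
  have [||Y [cY conY lt]] := small (comp F x).
  - by rewrite ltn_neqAle eq_sym nx.
  - by apply: leq_trans le; rewrite ltn_neqAle eq_sym ny.
  have := xi_min _ cY conY; have := cut_le x; split; lia.
case/and3P: PX0 => _ /eqP cX0 conX0.
have extra : extra_edge_cut h (cut X0).
  have cl : closed (@adj (del_edges (cut X0))) X0.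
    move=> u v /andP[uv]; rewrite mem_cut //.
    by case: (u \in X0); case: (v \in X0).
  apply/and3P; split; first exact: cut_sub_edges.
    apply/negP => con.
    have cC := cardsC X0.
    have /card_gt0P[x xX] : 0 < #|X0| by rewrite cX0.
    have /card_gt0P[y] : 0 < #|~: X0| by lia.
    move: con => /forallP/(_ x)/forallP/(_ y) xy.
    by rewrite inE -(closed_connect cl xy) xX.
  apply/forall_inP => _ /componentsP[x ->].
  pose C := comp (cut X0) x; change (h < #|C|).
  have [xX|xX] := boolP (x \in X0).
    rewrite -cX0; apply/subset_leq_card/subsetP => y yX; rewrite inE.
    apply: (induced_connect _ conX0) => // u v uX vX uv.
    by apply/andP; rewrite mem_cut // uX vX.
  have dis : [disjoint X0 & C].
    rewrite disjoint_subset; apply/subsetP => y yX; rewrite !inE.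
    by apply: contra xX => xy; rewrite (closed_connect cl xy).
  rewrite ltnNge; apply/negP => small_C.
  have C0 : 0 < #|C| by apply/card_gt0P; exists x; rewrite inE connect0.
  have cY : #|X0 :|: C| = h.+1 + #|C|.
    by rewrite cardsU (eqP (_ : X0 :&: C == set0)) ?setI_eq0 // cards0 subn0 cX0.
  have cYC := cardsC (X0 :|: C).
  (* The union has between [h + 2] and [2 * h + 1] vertices, so [3 * h + 3 <= #|H|] leaves at least
     [h + 2] outside. *)
  have [||Y [cardY conY]] := small (X0 :|: C); try lia.
  apply/negP; rewrite -leqNgt; apply: leq_trans (xi_min _ cardY conY).
  (* Edges leaving [C] are deleted ones, so the cut of the union is contained in [cut X0]. *)
  rewrite xiE; apply/subset_leq_card/subsetP => e.
  case/cutP=> u [v [uY vY uv ->]]; rewrite -/(cut X0).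
  move: vY; rewrite in_setU negb_or => /andP[vX vC].
  move: uY; rewrite in_setU => /orP[uX|uC].
    by rewrite mem_cut // uX (negPf vX).
  apply: contraNT vC => nF; move: uC; rewrite !inE => xu.
  by apply: connect_trans xu _; apply: connect1; apply/andP.
have lamE : lambda h H = xi h H.
  rewrite /lambda.
  have [F exF min] := arg_min_defaultP (edges H)
    (fun F : {set {set H}} => #|F|) extra.
  apply/eqP; rewrite eqn_leq (low _ exF).1 andbT xiE.
  exact: (min (cut X0)).
rewrite /super_lambda /lambda_optimal /lambda_connected cH lamE eqxx /= andbT.
apply/andP; split; first by apply/existsP; exists (cut X0).
apply/forall_inP => F /andP[exF /eqP eF].
have [C Cc sC] := (low _ exF).2 (eq_leq (etrans eF lamE)).
by apply/exists_inP; exists C.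
Qed.

(** * Cuts of edges and of three-vertex paths *)

Section Star.
Variables (H : sgraph) (b : H) (X : {set H}).
Hypotheses (bX : b \in X) (starX : {in X, forall x, x != b -> adj b x}).

Lemma star_connected : connected (induced X).
Proof.
have tob (x : induced X) : connect adj (Sub b bX : induced X) x.
  have [e|nxb] := eqVneq (val x) b.
    by rewrite (_ : Sub b bX = x) ?connect0 //; apply: val_inj.
  by apply: connect1; apply: starX => //; exact: valP.
apply/forallP => x; apply/forallP => y.
by apply: connect_trans (tob y); rewrite sconnect_sym.
Qed.

(** Each of the [#|X|.-1] edges from the centre [b] to the rest of [X] contributes two arcs to
    [arcs_in X]. *)
Lemma degree_star : degree_set X + 2 * #|X|.-1 <= \sum_(x in X) deg x.
Proof.
rewrite sum_deg leq_add2l /arcs_in (bigD1 b) //= (cardsD1 b) bX add1n /=.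
have -> : #|X :\ b| = \sum_(x in X | x != b) 1.
  by rewrite -sum1_card; apply: eq_bigl => x; rewrite !inE andbC.
rewrite mul2n -addnn; apply: leq_add; last first.
  apply: leq_sum => x /andP[xX xb]; rewrite (bigD1 b) //= adj_sym.
  by rewrite starX.
rewrite [leqRHS](bigD1 b) //=; apply: leq_trans (leq_addl _ _).
by apply: leq_sum => x /andP[xX xb]; rewrite starX.
Qed.

End Star.

Lemma deg_gt0P (H : sgraph) (x : H) : 0 < deg x -> exists y, adj x y.
Proof. by rewrite degE => /card_gt0P[y]; rewrite inE; exists y. Qed.

Lemma pair_star (H : sgraph) (u w : H) : adj u w ->
  [/\ #|[set u; w]| = 2, connected (induced [set u; w]) &
      degree_set [set u; w] + 2 <= deg u + deg w].
Proof.
move=> uw; have nuw : u != w by apply: contraTneq uw => ->; rewrite adj_irr.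
have c2 : #|[set u; w]| = 2 by rewrite cards2 nuw.
have st : {in [set u; w], forall x, x != u -> adj u x}.
  by move=> x; rewrite !inE => /orP[]/eqP->; rewrite ?eqxx.
split=> //; first by apply: (star_connected _ st); rewrite set21.
have := degree_star (set21 u w) st.
by rewrite c2 big_setU1 ?inE //= big_set1.
Qed.

Lemma cherry_star (H : sgraph) (b : H) : 1 < deg b ->
  exists Y : {set H}, [/\ #|Y| = 3, connected (induced Y) &
    degree_set Y + 4 <= \sum_(x in Y) deg x].
Proof.
rewrite degE => /card_gt1P[x [y []]]; rewrite !inE => bx by_ nxy.
have nb z : adj b z -> b != z by move=> bz; apply: contraTneq bz => ->; rewrite adj_irr.
pose Y := b |: [set x; y].
have st : {in Y, forall x, x != b -> adj b x}.
  by move=> z; rewrite !inE => /or3P[]/eqP->; rewrite ?eqxx.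
have cY : #|Y| = 3 by rewrite cardsU1 cards2 !inE negb_or !nb // nxy.
exists Y; split=> //; first exact: star_connected (setU11 _ _) st.
by have := degree_star (setU11 _ _) st; rewrite cY.
Qed.

(** * Degrees lost to deleted edges *)

Section Deletion.
Variables (H : sgraph) (F : {set {set H}}).
Local Notation HF := (del_edges F).

Definition fdeg (u : H) := \sum_y (adj u y && ([set u; y] \in F)).

Lemma deg_del (u : H) : @deg HF u + fdeg u = deg u.
Proof.
rewrite /deg /fdeg -big_split; apply: eq_bigr => y _ /=.
by rewrite /del_adj /=; case: adj => //=; case: (_ \in F).
Qed.

(** Charges deleted edges to their ends in [X]; for small [X] this can beat the bound by [#|F|]. *)
Lemma degree_set_del_local (X : {set H}) :
  degree_set X <= @degree_set HF X + \sum_(x in X) fdeg x.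
Proof.
rewrite !degree_setE -big_split; apply: leq_sum => x _ /=.
apply: (@leq_trans (\sum_(y in ~: X) (@adj HF x y + (adj x y && ([set x; y] \in F))))).
  apply: leq_sum => y _ /=.
  by rewrite /del_adj /=; case: adj => //=; case: (_ \in F).
rewrite big_split leq_add2l big_mkcond; apply: leq_sum => y _.
by case: ifP.
Qed.

End Deletion.

(** * Regular triangle-free graphs with large cuts *)

Section Regular.
Variables (H : sgraph) (k : nat).
Hypotheses (tf : triangle_free H) (reg : forall x : H, deg x = k + 2).

Lemma regular_small_cut (X : {set H}) :
  2 * #|X| * (k + 2) <= 2 * degree_set X + #|X| ^ 2.
Proof.
have := sum_deg X; rewrite (eq_bigr (fun=> k + 2)) //= sum_nat_const => e.
have := mantel X tf; lia.
Qed.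

Hypothesis k3 : 3 <= k.
Hypothesis big : forall X : {set H},
  4 <= #|X| -> 4 <= #|~: X| -> 3 * k + 3 <= degree_set X.

(** Mantel's bound is [k + 3/2], [2k + 2] and [3k + 3/2] for one, two and three vertices;
    integrality rounds it up. *)
Lemma cut_le3 (X : {set H}) : #|X| <= 3 ->
  [/\ 0 < #|X| -> k + 2 <= degree_set X & #|X| = 3 -> 3 * k + 2 <= degree_set X].
Proof.
have := regular_small_cut X.
by case: #|X| => [|[|[|[|]]]] // le _; split=> // _; lia.
Qed.

Lemma cut_ge (X : {set H}) : 0 < #|X| -> 0 < #|~: X| -> k + 2 <= degree_set X.
Proof.
move=> X0 XC0; have [l3|g3] := leqP #|X| 3; first by have [-> //] := cut_le3 l3.
have [l3'|g3'] := leqP #|~: X| 3; last by have := big g3 g3'; lia.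
by rewrite -degree_setC; have [-> //] := cut_le3 l3'.
Qed.

Lemma cut_ge3 (X : {set H}) :
  3 <= #|X| -> 3 <= #|~: X| -> 3 * k + 2 <= degree_set X.
Proof.
move=> X0 XC0; have [l3|g3] := leqP #|X| 3.
  by have [_ -> //] := cut_le3 l3; lia.
have [l3'|g3'] := leqP #|~: X| 3; last by have := big g3 g3'; lia.
by rewrite -degree_setC; have [_ -> //] := cut_le3 l3'; lia.
Qed.

Hypothesis N10 : 10 <= #|H|.

Lemma regular_super2 : super_lambda 2 H.
Proof.
have /card_gt0P[b _] : 0 < #|H| by lia.
apply: super_lambdaI => [|||X X4 XC4]; try lia.
  by apply: cut_connected => X X0 XC0; have := cut_ge X0 XC0; lia.
have [|Y [cY conY dY]] := @cherry_star _ b; first by rewrite reg; lia.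
exists Y; split=> //; have := big X4 XC4; move: dY.
rewrite (eq_bigr (fun=> k + 2)) // sum_nat_const cY; lia.
Qed.

Lemma regular_super1 : super_lambda 1 H.
Proof.
have /card_gt0P[b _] : 0 < #|H| by lia.
apply: super_lambdaI => [|||X X4 XC4]; try lia.
  by apply: cut_connected => X X0 XC0; have := cut_ge X0 XC0; lia.
have [|w bw] := @deg_gt0P _ b; first by rewrite reg; lia.
have [c2 con2 d2] := pair_star bw.
(* An edge has cut at most [2 (k + 2) - 2 = 2k + 2], below the [3k + 2] of [cut_ge3]. *)
exists [set b; w]; split=> //; have := cut_ge3 X4 XC4; move: d2.
rewrite !reg; lia.
Qed.

(* An edge at a vertex meeting the most deleted edges, mu of them, has small
   degree in G - F; a cut of G - F around three vertices has lost at most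
   3 * mu edges. *)
Lemma regular_persists : persists H (k + 1).
Proof.
move=> F _ cF; set HF := del_edges F.
have /card_gt0P[b _] : 0 < #|H| by lia.
have dF (X : {set H}) : degree_set X <= @degree_set HF X + (k + 1).
  by apply: leq_trans (degree_set_del F X) _; rewrite leq_add2l.
have [u _ umax] := @arg_maxnP _ b predT (fdeg F) isT.
have dL (X : {set H}) : degree_set X <= @degree_set HF X + #|X| * fdeg F u.
  apply: leq_trans (degree_set_del_local F X) _; rewrite leq_add2l.
  by rewrite -sum_nat_const; apply: leq_sum => x _; exact: umax.
have NF : 10 <= #|HF| by exact: N10.
have con (X : {set H}) : 0 < #|X| -> 0 < #|~: X| -> 0 < @degree_set HF X.
  by move=> X0 XC0; have := cut_ge X0 XC0; have := dF X; lia.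
apply: super_lambdaI => [|||X X3 XC3]; try lia.
  exact: (@cut_connected HF con).
have dsum (x : H) : @deg HF x + fdeg F x = k + 2 by rewrite deg_del reg.
have [|w uw] := @deg_gt0P HF u.
  have := sum_deg ([set u] : {set HF}); rewrite big_set1 => ->.
  have /con: 0 < #|[set u]| by rewrite cards1.
  have := cardsC [set u]; rewrite cards1 => cC.
  have -> : 0 < #|~: [set u]| by lia.
  by move/(_ isT); lia.
have [c2 con2 d2] := pair_star uw.
exists [set u; w]; split=> //.
have du := dsum u; have dw := dsum w; have dX := dF X; have lX := dL X.
have lXC : degree_set (X : {set H}) <= @degree_set HF X + #|~: (X : {set H})| * fdeg F u.
  by rewrite -degree_setC -(@degree_setC HF X); exact: dL.
have mu : degree_set (X : {set H}) <= @degree_set HF X + fdeg F u * 3 \/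
    3 * k + 3 <= degree_set (X : {set H}).
  have le3 n d d' : n <= 3 -> d <= d' + n * fdeg F u -> d <= d' + fdeg F u * 3 by nia.
  have [l3|g3] := leqP #|X| 3; first by left; apply: le3 lX.
  have [l3'|g3'] := leqP #|~: X| 3; first by left; apply: le3 lXC.
  by right; exact: big.
change (@degree_set HF [set u; w] < @degree_set HF X).
have := cut_ge3 X3 XC3.
have m0 : fdeg F u = 0 -> degree_set (X : {set H}) <= @degree_set HF X.
  by move=> e; rewrite e muln0 addn0 in lX.
have d2' : @degree_set HF [set u; w] + 2 <= @deg HF u + @deg HF w := d2.
(* With [f = fdeg F u], the edge has cut at most [2k + 2 - f] and [X] at least [2k + 1], which
   settles [f >= 2]. For [f = 1], [X] keeps at least [3k - 1] or [2k + 2] edges, enough as [k >= 3];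
   for [f = 0] it keeps at least [3k + 2]. *)
move: (@degree_set HF X) (@degree_set HF [set u; w]) (@deg HF u) (@deg HF w)
  (fdeg F u) (fdeg F w) (@degree_set H X) du dw dX mu m0 d2' k3; clear.
lia.
Qed.

Lemma regular_persistence : persistence_is H (k + 1).
Proof.
split; [exact: regular_super1 | exact: regular_persists | move=> s ps].
rewrite leqNgt; apply/negP => ls.
have /card_gt0P[u _] : 0 < #|H| by lia.
have cF : #|cut [set u]| <= s.
  apply: leq_trans ls; rewrite -/(degree_set [set u]).
  by have := sum_deg [set u]; rewrite big_set1 reg; lia.
have := ps _ (cut_sub_edges [set u]) cF.
case/andP => /andP[/andP[con _] _] _.
have cC := cardsC [set u]; rewrite cards1 in cC.
have : 0 < @degree_set (del_edges (cut [set u])) [set u].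
  by apply: connected_cut con _ _; rewrite ?cards1 //=; lia.
rewrite /degree_set -/(@cut (del_edges (cut [set u])) [set u]).
by rewrite cut_del setDv cards0.
Qed.

End Regular.

(** * Adjacency and degrees in the cyclic graph *)

Lemma val_ordS m (i : 'I_m) :
  ordS i = (if i.+1 == m then 0 else i.+1) :> nat.
Proof.
rewrite /=; case: eqP => [->|ne]; first by rewrite modnn.
by rewrite modn_small // ltn_neqAle ltn_ord andbT; apply/eqP.
Qed.

Section CyclicGraph.
Variables (m k n : nat) (G : 'I_m -> sgraph).
Variable M : forall i : 'I_m, G i -> G (ordS i).
Hypothesis m4 : 4 <= m.
Hypothesis bijM : forall i : 'I_m, bijective (@M i).

Local Notation V := {i : 'I_m & G i}.
Local Notation T := (Tagged (fun i => G i : Type)).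
Local Notation C := (cyclic_graph M).

Definition next (u : V) : V := T (M (tagged u)).

Lemma next_inj : injective next.
Proof.
move=> [i x] [j y] /= e.
have eij : i = j by apply: ordS_inj; exact: (congr1 tag e).
case: j / eij y e => y e; congr (Tagged _ _).
apply: (bij_inj (bijM i)); move/eqP: e.
by rewrite eq_Tagged /= => /eqP.
Qed.

Lemma next_bij : bijective next.
Proof. exact: injF_bij next_inj. Qed.

Lemma layer_tag (u v : V) : layer_adj u v -> tag u = tag v :> nat.
Proof. by case/andP=> /eqP e _; congr (nat_of_ord _). Qed.

Lemma layer_irr (u : V) : layer_adj u u = false.
Proof. by case: u => i x; rewrite /layer_adj /= eqxx tagged_asE adj_irr. Qed.

Lemma layer_Tagged i (x y : G i) : layer_adj (T x) (T y) = adj x y.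
Proof. by rewrite /layer_adj /= eqxx tagged_asE. Qed.

Lemma next_tag u v : next u = v ->
  tag v = (tag u).+1 :> nat \/ (tag u).+1 = m /\ tag v = 0 :> nat.
Proof. by move=> <-; rewrite val_ordS; case: eqP; [right|left]. Qed.

Lemma cyclic_adjP u v :
  @adj C u v -> [\/ layer_adj u v, next u = v | next v = u].
Proof.
by case/andP=> _ /or3P[?|/eqP ?|/eqP ?]; [apply: Or31|apply: Or32|apply: Or33].
Qed.

(** A layer edge keeps the tag and a matching edge shifts it by one modulo [m]; as [m >= 4], forward
    and backward shifts differ, so the three alternatives are exclusive. *)
Lemma cyclic_adj_split u v :
  @adj C u v = layer_adj u v + (next u == v) + (next v == u) :> nat.
Proof.
rewrite /= /cyclic_adj /match_adj /= -!/(next _).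
have tu := ltn_ord (tag u); have tv := ltn_ord (tag v).
have [e|ne] := eqVneq u v.
  rewrite e layer_irr /=; have [nv|//] := eqVneq.
  by have := next_tag nv; lia.
have [l|_] := boolP (layer_adj u v).
  have t := layer_tag l.
  have [/next_tag|_] := eqVneq (next u) v; first lia.
  by have [/next_tag|_] := eqVneq (next v) u; first lia.
have [/next_tag t|_] //= := eqVneq (next u) v.
by have [/next_tag|_] := eqVneq (next v) u; first lia.
Qed.

Hypothesis tfG : forall i : 'I_m, triangle_free (G i).

(** Around a triangle the tag shifts sum to zero modulo [m], hence to zero as [m > 3]. Either all
    edges lie in one layer, or there is one layer edge, one forward and one backward step, and then
    the ends of the layer edge coincide because [next] is an injective function. *)
Lemma cyclic_triangle_free : triangle_free C.
Proof.
apply/forallP => u; apply/forallP => v; apply/forallP => w.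
apply/negP => /and3P[/cyclic_adjP uv /cyclic_adjP vw /cyclic_adjP wu].
have tu := ltn_ord (tag u); have tv := ltn_ord (tag v); have tw := ltn_ord (tag w).
have key x y : layer_adj (G := G) x y -> x <> y.
  by move=> l e; rewrite e layer_irr in l.
case: uv => [uv|uv|uv]; case: vw => [vw|vw|vw]; case: wu => [wu|wu|wu];
  try (by apply: (key _ _ uv); try apply: next_inj; congruence);
  try (by apply: (key _ _ vw); try apply: next_inj; congruence);
  try (by apply: (key _ _ wu); try apply: next_inj; congruence);
  try (have := next_tag uv); try (have := next_tag vw);
  try (have := next_tag wu); try (have := layer_tag uv);
  try (have := layer_tag vw); try (have := layer_tag wu); try lia.
move=> _ _ _; move: u v w uv vw wu {tu tv tw key} => [i x] [j y] [l z] uv vw wu.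
have /eqP eij := proj1 (andP uv); have /eqP ejl := proj1 (andP vw).
rewrite /= in eij ejl; case: j / eij y uv vw ejl => y uv vw eil.
case: l / eil z vw wu => z; move: uv; rewrite !layer_Tagged => uv vw wu.
move: (tfG i) => /forallP/(_ x)/forallP/(_ y)/forallP/(_ z).
by rewrite uv vw wu.
Qed.

Lemma sum_layers (P : pred V) (f : V -> nat) :
  \sum_(u | P u) f u = \sum_i \sum_(x : G i | P (T x)) f (T x).
Proof.
rewrite sig_big_dep /=; apply: eq_big => [u|u _]; by rewrite taggedK.
Qed.

Lemma sum_layer_adj (P : pred V) i (x : G i) :
  \sum_(v | P v) layer_adj (T x) v = \sum_(y : G i | P (T y)) adj x y.
Proof.
rewrite sum_layers (bigD1 i) //= [X in _ + X]big1 ?addn0.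
  by apply: eq_bigr => y _; rewrite layer_Tagged.
move=> j ji; apply: big1 => y _.
by rewrite /layer_adj /= eq_sym (negPf ji).
Qed.

Lemma sum_eqr (P : pred V) u : \sum_(v | P v) (u == v) = P u.
Proof.
case Pu: (P u); last first.
  by apply: big1 => v Pv; case: eqP => // e; rewrite e Pv in Pu.
rewrite (bigD1 u) //= eqxx big1 // => v /andP[_ vu].
by rewrite eq_sym (negPf vu).
Qed.

Hypothesis regG : forall i : 'I_m, regular k (G i).

Lemma cyclic_deg u : @deg C u = k + 2.
Proof.
rewrite /deg; under eq_bigr => v _ do rewrite cyclic_adj_split.
rewrite !big_split /=.
have -> : \sum_v (next v == u) = 1.
  have [g gK Kg] := next_bij.
  under eq_bigr => v _ do rewrite (can2_eq gK Kg) eq_sym.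
  exact: (sum_eqr predT).
rewrite (sum_eqr predT) -addnA; congr (_ + _).
case: u => i x; rewrite (sum_layer_adj predT).
by have := forallP (regG i) x => /eqP <-; rewrite -degE.
Qed.

Hypothesis cardG : forall i : 'I_m, #|G i| = n.

Lemma card_cyclic : #|C| = m * n.
Proof.
rewrite card_tagged sumnE big_map big_enum /= (eq_bigr (fun=> n)) //.
by rewrite sum_nat_const card_ord.
Qed.

Hypothesis k3 : 3 <= k.
Hypothesis conG : forall i : 'I_m, edge_connected k (G i).
Hypothesis n_big : 3 * k + 4 <= 2 * n.

(** * Cuts of the cyclic graph, layer by layer *)

Section Cut.
Variable X : {set V}.

Definition part i : {set G i} := [set x | T x \in X].
(** The cut edges of a matching are split by direction, so that gain minus loss is the change in
    layer size. *)
Definition gain i := \sum_(x : G i) ((T x \notin X) && (next (T x) \in X)).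
Definition loss i := \sum_(x : G i) ((T x \in X) && (next (T x) \notin X)).

Lemma card_part : #|X| = \sum_i #|part i|.
Proof.
rewrite -sum1_card sum_layers; apply: eq_bigr => i _.
by rewrite -sum1_card; apply: eq_bigl => x; rewrite inE.
Qed.

Lemma part_sum i : #|part i| = \sum_(x : G i) (T x \in X).
Proof.
by rewrite -sum1_card big_mkcond; apply: eq_bigr => x _; rewrite inE; case: ifP.
Qed.

Lemma part_step i : #|part i| + gain i = #|part (ordS i)| + loss i.
Proof.
rewrite !part_sum (reindex (@M i)) /=; last exact: onW_bij.
rewrite -!big_split; apply: eq_bigr => x _.
by rewrite /next /=; case: (T x \in X); case: (T (M x) \in X).
Qed.

(** The layer sizes return to their start after one turn around the cycle. *)
Lemma sum_gain_loss : \sum_i gain i = \sum_i loss i.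
Proof.
have /eqP : \sum_i (#|part i| + gain i) = \sum_i (#|part (ordS i)| + loss i).
  by apply: eq_bigr => i _; exact: part_step.
rewrite !big_split /= [X in _ == X + _](_ : _ = \sum_i #|part i|).
  by rewrite eqn_add2l => /eqP.
by rewrite [RHS](reindex (@ordS m)) //; exact/onW_bij/ordS_bij.
Qed.

Lemma degree_set_layers :
  @degree_set C X = \sum_i degree_set (part i) + 2 * \sum_i gain i.
Proof.
rewrite degree_setE.
under eq_bigr => u _ do under eq_bigr => v _ do rewrite cyclic_adj_split.
under eq_bigr => u _ do rewrite !big_split /=.
rewrite !big_split /= mul2n -addnn {1}sum_gain_loss addnA.
congr (_ + _ + _).
- rewrite sum_layers; apply: eq_bigr => i _; rewrite degree_setE.
  apply: eq_big => [x|x _]; first by rewrite inE.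
  rewrite (sum_layer_adj (mem (~: X))).
  by apply: eq_bigl => y; rewrite !inE.
- rewrite sum_layers; apply: eq_bigr => i _; rewrite big_mkcond.
  apply: eq_bigr => x _; rewrite (sum_eqr (mem (~: X))) /= inE.
  by case: ifP.
rewrite exchange_big /= sum_layers; apply: eq_bigr => i _; rewrite big_mkcond.
apply: eq_bigr => x _; rewrite inE; case: ifP => //= _.
exact: (sum_eqr (mem X)).
Qed.

(** Telescopes [part_step] from [i] to [j] without wrapping around. The bound by losses serves
    [part_le] when the target layer has the smaller index. *)
Lemma part_forward r (i j : 'I_m) : j = i + r :> nat ->
  #|part j| <= #|part i| + \sum_(t < m | i <= t < j) gain t /\
  #|part i| <= #|part j| + \sum_(t < m | i <= t < j) loss t.
Proof.
elim: r j => [|r IH] j ej.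
  have -> : j = i by apply: val_inj; rewrite /= ej addn0.
  by split; exact: leq_addr.
have lj := ltn_ord j.
have lj' : i + r < m by lia.
pose j' := Ordinal lj'; have eS : ordS j' = j.
  by apply: ord_inj; rewrite val_ordS /=; case: eqP; lia.
have [h1 h2] := IH j' erefl; have := part_step j'; rewrite eS.
have split_last (f : 'I_m -> nat) :
    \sum_(t < m | i <= t < j) f t = f j' + \sum_(t < m | i <= t < j') f t.
  rewrite (bigD1 j') /=; last by lia.
  congr (_ + _); apply: eq_bigl => t.
  by rewrite -val_eqE /=; lia.
by rewrite !split_last; lia.
Qed.

Lemma part_le (i j : 'I_m) : #|part j| <= #|part i| + \sum_i gain i.
Proof.
have sub (P : pred 'I_m) (f : 'I_m -> nat) : \sum_(t | P t) f t <= \sum_t f t.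
  by rewrite big_mkcond leq_sum // => t _; case: ifP.
have [le|lt] := leqP i j.
  have [h _] := @part_forward (j - i) i j ltac:(lia).
  by apply: leq_trans h _; rewrite leq_add2l.
have [_ h] := @part_forward (i - j) j i ltac:(lia).
by apply: leq_trans h _; rewrite leq_add2l sum_gain_loss.
Qed.

Definition mixed : {set 'I_m} := [set i | 0 < #|part i| < n].

Lemma part_setC i : #|part i| + #|~: part i| = n.
Proof. by rewrite cardsC cardG. Qed.

Lemma degree_set_mixed :
  k * #|mixed| + 2 * \sum_i gain i <= @degree_set C X.
Proof.
rewrite degree_set_layers leq_add2r mulnC -sum_nat_const big_mkcond.
apply: leq_sum => i _; case: ifP => //; rewrite inE => /andP[p0 pn].
apply: edge_connected_cut => //; have := part_setC i; lia.
Qed.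

(** Next to an empty layer, every layer size is at most the total gain [g]. A full layer gives
    [2g >= 2n >= 3k + 4]. Otherwise [X] lies in [p] mixed layers, so [p g >= 2k + 1], and [k p + 2g]
    is large enough. *)
Lemma degree_set_empty_layer i :
  #|part i| = 0 -> 2 * k + 1 <= #|X| -> 3 * k + 3 <= @degree_set C X.
Proof.
move=> ei cX; apply: leq_trans degree_set_mixed.
set g := \sum_i gain i.
have le j : #|part j| <= g by have := part_le i j; rewrite ei.
have [/existsP[j /eqP ej]|/existsPn nfull] := boolP [exists j, #|part j| == n].
  by have := le j; rewrite ej; lia.
have : #|X| <= #|mixed| * g.
  rewrite card_part -sum_nat_const [leqRHS]big_mkcond; apply: leq_sum => j _.
  rewrite inE; case: ifP => // /negbT; rewrite negb_and -leqNgt leqn0.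
  case/orP => [/eqP -> //|]; rewrite -leqNgt => le_n.
  by have := nfull j; have := part_setC j; lia.
(* No mixed layer contradicts [cX]; one, two or three force [g] to be at least [2k + 1], [k + 1] or
   3; four or more contribute [4k >= 3k + 3]. *)
move: g {le} #|mixed| => g [|[|[|[|p]]]]; nia.
Qed.

End Cut.

Lemma cyclic_cut (X : {set C}) :
  4 <= #|X| -> 4 <= #|~: X| -> 3 * k + 3 <= degree_set X.
Proof.
move=> X4 XC4.
(* The Mantel bound [s (k + 2) - s^2 / 2] is concave in [s] and equals [4k >= 3k + 3] at both
   [s = 4] and [s = 2k]. *)
have small (Y : {set C}) :
    4 <= #|Y| -> #|Y| <= 2 * k -> 3 * k + 3 <= degree_set Y.
  have := regular_small_cut cyclic_triangle_free cyclic_deg Y.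
  move: #|Y| (degree_set Y) => s d; nia.
have [le|gt] := leqP #|X| (2 * k); first exact: small.
have [le|gt'] := leqP #|~: X| (2 * k).
  by rewrite -degree_setC; exact: small.
(* A layer that is not mixed is empty for [X] or for its complement, and both now have more than
   [2k] vertices. *)
have [/existsP[i]|/existsPn allmix] := boolP [exists i, i \notin mixed X].
  rewrite inE negb_and -leqNgt leqn0 => /orP[/eqP e0|].
    by apply: degree_set_empty_layer e0 _; rewrite addn1.
  rewrite -leqNgt => len; rewrite -degree_setC.
  apply: (@degree_set_empty_layer _ i); last by rewrite addn1.
  have -> : part (~: X) i = ~: part X i by apply/setP => x; rewrite !inE.
  by have := part_setC X i; lia.
have all : mixed X = setT.
  by apply/setP => i; rewrite in_setT; exact: negbNE (allmix i).
have := degree_set_mixed X; rewrite all cardsT card_ord; nia.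
Qed.

End CyclicGraph.

Theorem theorem4p7 (m k n : nat) (G : 'I_m -> sgraph)
    (M : forall i : 'I_m, G i -> G (ordS i)) :
  4 <= m -> 3 <= k ->
  (forall i : 'I_m, regular k (G i)) ->
  (forall i : 'I_m, edge_connected k (G i)) ->
  (forall i : 'I_m, #|G i| = n) ->
  (forall i : 'I_m, triangle_free (G i)) ->
  (forall i : 'I_m, bijective (M i)) ->
  uphalf (3 * k + 2) < n ->
  super_lambda 2 (cyclic_graph M) /\ persistence_is (cyclic_graph M) (k + 1).
Proof.
move=> m4 k3 regG conG cardG tfG bijM n_big.
(* In this form the bound covers a full layer and an empty one, which together force at least [2n]
   matching edges into the cut. *)
have {}n_big : 3 * k + 4 <= 2 * n by lia.
have N10 : 10 <= #|cyclic_graph M| by rewrite (card_cyclic M cardG); nia.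
have tf := cyclic_triangle_free m4 bijM tfG.
have reg := cyclic_deg m4 bijM regG.
have cut := cyclic_cut m4 bijM tfG regG cardG k3 conG n_big.
by split; [exact: (regular_super2 tf reg) | exact: (regular_persistence tf reg)].
Qed.
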